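(* If $G$ is the line graph of a graph $H$ with minimum degree $\delta(H)\ge 2$, then $\mathrm{a}_1(G)=\mathrm{a}_1'(G)=1$.
   Context: Graphs are finite, simple and undirected. The line graph $L(H)$ of $H$ has the edges of $H$ as vertices, two of them being adjacent iff the corresponding edges share a vertex in $H$. For positive integers $a,b$, the $(a,b)$-biased Maker-Breaker domination game on a graph $G$ is played by Dominator and Staller, who move alternately; on each move Dominator selects $a$ unplayed vertices and Staller selects $b$ unplayed vertices (if fewer unplayed vertices remain than the player's bias, the player selects all remaining ones). Dominator wins if the vertices he selected during the game form a dominating set of $G$; otherwise Staller wins, equivalently, Staller wins iff she claims all vertices of the closed neighborhood of some vertex. In the D-game Dominator moves first; in the S-game Staller moves first. For a positive integer $\ell$, $\mathrm{a}_\ell(G)$ (resp. $\mathrm{a}'_\ell(G)$) is the minimum positive integer $a$ such that Dominator wins the $(a,\ell)$-biased D-game (resp. S-game) on $G$ under optimal play ($\infty$ if no such $a$ exists). *)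

(* Defs.v *)
From mathcomp Require Import all_boot.
From mathcomp Require Import boolp.

Set Implicit Arguments.
Unset Strict Implicit.
Unset Printing Implicit Defensive.

Record sgraph := SGraph {
  vertex :> finType;
  adj : rel vertex;
  adj_sym : symmetric adj;
  adj_irrefl : irreflexive adj }.

Definition degree (H : sgraph) (v : H) : nat := #|[set w : H | adj v w]|.

(* Every degree is smaller than #|H|, so the default value of the minimum is
   only visible on the graph without vertices, whose minimum degree is 0. *)
Definition min_degree (H : sgraph) : nat := \big[minn/#|H|]_(v : H) degree v.

Definition edges (H : sgraph) : {set {set H}} :=
  [set [set p.1; p.2] | p : H * H & adj p.1 p.2].

Section LineGraph.
Variable H : sgraph.

Definition edge_type : finType := {e : {set H} | e \in edges H}.

Definition line_adj : rel edge_type :=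
  fun e f => (e != f) && (val e :&: val f != set0).

Lemma line_adj_sym : symmetric line_adj.
Proof. by move=> e f; rewrite /line_adj eq_sym setIC. Qed.

Lemma line_adj_irrefl : irreflexive line_adj.
Proof. by move=> e; rewrite /line_adj eqxx. Qed.

Definition line_graph : sgraph := SGraph line_adj_sym line_adj_irrefl.

End LineGraph.

Definition dominating (G : sgraph) (D : {set G}) : Prop :=
  forall v : G, exists2 u : G, u \in D & (u == v) || adj u v.

Inductive player := Dominator | Staller.

Section Game.
Variables (a b : nat) (G : sgraph).

Definition unplayed (D S : {set G}) : {set G} := ~: (D :|: S).

Definition legal (k : nat) (D S M : {set G}) : Prop :=
  M \subset unplayed D S /\ #|M| = minn k #|unplayed D S|.

(* [dom_wins p D S]: Dominator has a winning strategy from the position in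
   which he has selected D, Staller has selected S and it is p's turn.  For
   positive biases every play is finite, so that the least such predicate is
   the outcome of the game under optimal play. *)
Inductive dom_wins : player -> {set G} -> {set G} -> Prop :=
| WinsEnd p D S :
    unplayed D S = set0 -> dominating D -> dom_wins p D S
| WinsDominator D S M :
    unplayed D S <> set0 -> legal a D S M ->
    dom_wins Staller (D :|: M) S -> dom_wins Dominator D S
| WinsStaller D S :
    unplayed D S <> set0 ->
    (forall M, legal b D S M -> dom_wins Dominator D (S :|: M)) ->
    dom_wins Staller D S.

Definition dom_wins_Dgame : Prop := dom_wins Dominator set0 set0.
Definition dom_wins_Sgame : Prop := dom_wins Staller set0 set0.

End Game.

(* The value None stands for infinity. *)
Definition least_positive (W : nat -> Prop) : option nat :=
  if pselect (exists a, (0 < a) && `[< W a >]) is left exW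
  then Some (ex_minn exW) else None.

Definition a_Dgame (l : nat) (G : sgraph) : option nat :=
  least_positive (fun a => dom_wins_Dgame a l G).

Definition a_Sgame (l : nat) (G : sgraph) : option nat :=
  least_positive (fun a => dom_wins_Sgame a l G).

(* Main.v *)
(* Dominator has to touch at least one end of every edge of [H].  Since all
   degrees are at least 2, one can choose distinct edges [f v], one at each
   vertex [v].  Dominator keeps the following invariant before each of
   Staller's moves: every edge of Staller has a touched end, and every untouched
   vertex [v] that still has a free edge has [f v] free.  Let Staller take [e].
   If [e = f u] with [u] untouched and another edge at [u] is free, Dominator
   takes such an edge.  Otherwise the second half of the invariant survives, and
   if both ends of [e] are untouched, one of them, [w], has [f w != e], and
   Dominator takes [f w].  In the remaining case any move will do. *)
Require Import Defs.
From mathcomp Require Import all_boot.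
From mathcomp Require Import boolp.

Set Implicit Arguments.
Unset Strict Implicit.
Unset Printing Implicit Defensive.

(** * Distinct edges, one chosen at each vertex *)

Lemma min_degree_le (H : sgraph) (v : H) : min_degree H <= degree v.
Proof.
rewrite /min_degree; elim: (index_enum H) (mem_index_enum v) => // x r IH.
rewrite inE big_cons => /predU1P [<-|/IH le_r]; first exact: geq_minl.
exact: leq_trans (geq_minr _ _) le_r.
Qed.

Lemma degree_gt1_neighbor (H : sgraph) (v p : H) :
  1 < degree v -> exists2 w, adj v w & w != p.
Proof.
rewrite /degree (cardsD1 p) => lt1.
have /card_gt0P [w] : 0 < #|[set w | adj v w] :\ p|.
  by move: lt1; case: (p \in _) => //; apply: ltn_trans.
by rewrite !inE => /andP [wp vw]; exists w.
Qed.

(* A walk without backtracking is followed from [r], coming from [p], until it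
   meets [A]; it is then restarted from any vertex left over. *)
Lemma extend_successor (H : sgraph) (A : {set H}) (r p : H) (s : H -> H) :
    (forall v : H, 1 < degree v) -> r \notin A ->
    {in A, forall x, [/\ adj x (s x), s x \in r |: A,
                         s (s x) = x -> s x = r & s x = r -> x = p]} ->
  exists t : H -> H, forall x, adj x (t x) /\ t (t x) <> x.
Proof.
move=> deg2; have [n] := ubnP #|~: A|.
elim: n A r p s => // n IH A r p s leAn rA sP.
(* Only [p] can have [r] as its successor, so a successor of [r] other than [p] creates no
   2-cycle. *)
have [y ry yp] := degree_gt1_neighbor p (deg2 r).
have yr : y != r by apply: contraTneq ry => ->; rewrite adj_irrefl.
pose t := [eta s with r |-> y].
have tr : t r = y by rewrite /t /= eqxx.
have tE x : x \in A -> t x = s x.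
  by move=> xA; rewrite /t /=; case: eqP => // xr; rewrite -xr xA in rA.
pose B := r |: A.
have ltBn : #|~: B| < n.
  rewrite -ltnS; apply: leq_trans leAn; rewrite ltnS; apply: proper_card.
  by rewrite properC properE subsetUr subUset sub1set (negPf rA).
have tadj x : x \in B -> adj x (t x).
  by case/setU1P => [->|xA]; [rewrite tr | rewrite tE //; case: (sP x xA)].
have stepA x : x \in A -> t x \in B.
  by move=> xA; rewrite tE //; case: (sP x xA).
have ttr : y \in B -> t y <> r.
  case/setU1P => [/eqP|yA]; first by rewrite (negPf yr).
  rewrite tE // => syr; case: (sP y yA) => _ _ _ /(_ syr) /eqP.
  by rewrite (negPf yp).
have ttA x : x \in A -> t (t x) <> x.
  move=> xA; rewrite (tE _ xA); have [_ sB ss sr] := sP x xA.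
  have [sxr|sxr] := eqVneq (s x) r.
    by rewrite sxr tr (sr sxr); apply/eqP.
  have sxA : s x \in A by move: sB; rewrite !inE (negPf sxr).
  by rewrite tE // => /ss /eqP; rewrite (negPf sxr).
(* If [y] is new, the walk goes on from it; [r] is its only predecessor, because [t] maps [A] into
   [B]. *)
have [yB|yB] := boolP (y \in B); last first.
  apply: (IH B y r t) => // x xB; split; first exact: tadj.
  - case/setU1P: xB => [->|/stepA tB]; first by rewrite tr setU11.
    by apply/setU1P; right.
  - by case/setU1P: xB => [->|/ttA //]; rewrite tr.
  - by case/setU1P: xB => // /stepA tB ty; rewrite -ty tB in yB.
have tB x : x \in B -> t x \in B by case/setU1P => [->|/stepA]; rewrite ?tr.
have tt x : x \in B -> t (t x) <> x.
  by case/setU1P => [->|/ttA //]; rewrite tr; apply: ttr.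
have [BT|] := eqVneq (~: B) set0.
  exists t => x; have xB : x \in B by rewrite -[B]setCK BT !inE.
  by split; [apply: tadj | apply: tt].
(* [t] now maps [B] into itself, so [q] has no predecessor and the vertex to avoid, here [r], is
   arbitrary. *)
case/set0Pn => q; rewrite inE => qB; apply: (IH B q r t) => // x xB.
split; first exact: tadj.
- by rewrite inE tB ?orbT.
- by move/(tt x xB).
- by move=> tq; rewrite -tq tB in qB.
Qed.

(** Each vertex is given the edge to its successor. Two vertices sharing that edge would be
    successors of each other. *)
Lemma distinct_incident_edges (H : sgraph) :
    2 <= min_degree H ->
  exists2 f : H -> edge_type H, injective f & forall v, v \in val (f v).
Proof.
move=> hH.
have deg2 (v : H) : 1 < degree v by apply: leq_trans hH (min_degree_le v).
have [s sP] : exists s : H -> H, forall x, adj x (s x) /\ s (s x) <> x.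
  have [r _|noH] := pickP (@predT H); last by exists id => x; have := noH x.
  apply: (@extend_successor _ set0 r r id) => //; first by rewrite inE.
  by move=> x; rewrite inE.
have sE v : [set v; s v] \in edges H.
  by apply/imsetP; exists (v, s v) => //; rewrite inE; case: (sP v).
exists (fun v => exist (fun e => e \in edges H) _ (sE v)); last by move=> v; rewrite /= !inE eqxx.
move=> v w [eq_vw].
have /set2P [//|vsw] : v \in [set w; s w] by rewrite -eq_vw set21.
have /set2P [//|wsv] : w \in [set v; s v] by rewrite eq_vw set21.
by case: (sP v) => _ []; rewrite -wsv -vsw.
Qed.

(** * Dominator's strategy and its invariant *)

Section Strategy.
Variables (H : sgraph) (f : H -> edge_type H).
Hypotheses (f_inj : injective f) (f_inc : forall v, v \in val (f v)).

Implicit Types (D S : {set line_graph H}) (e g : line_graph H).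

Definition touched D (v : H) := [exists g in D, v \in val g].

Definition dominated D S :=
  forall e, e \in S -> exists2 v, v \in val e & touched D v.

Definition reserved D S :=
  forall g v, ~~ touched D v -> g \in unplayed D S -> v \in val g ->
    f v \in unplayed D S.

Lemma unplayedU1l D S e g :
  (g \in unplayed (D :|: [set e]) S) = (g != e) && (g \in unplayed D S).
Proof. by rewrite !inE !negb_or -andbA andbCA. Qed.

Lemma unplayedU1r D S e g :
  (g \in unplayed D (S :|: [set e])) = (g != e) && (g \in unplayed D S).
Proof. by rewrite !inE !negb_or andbA andbC. Qed.

Lemma touchedU1 D e v :
  touched (D :|: [set e]) v = touched D v || (v \in val e).
Proof.
apply/exists_inP/orP => [[g] | [/exists_inP [g gD vg] | ve]].
- rewrite !inE => /orP [gD|/eqP ->]; last by right.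
  by move=> vg; left; apply/exists_inP; exists g.
- by exists g => //; rewrite inE gD.
- by exists e => //; rewrite !inE eqxx orbT.
Qed.

Lemma dominatedU1 D S e : dominated D S -> dominated (D :|: [set e]) S.
Proof.
by move=> dDS g /dDS [v vg tv]; exists v => //; rewrite touchedU1 tv.
Qed.

(** An edge taken by Dominator touches both its ends, so it is not [f v] for any [v] left
    untouched. *)
Lemma reservedU1 D S e : reserved D S -> reserved (D :|: [set e]) S.
Proof.
move=> rDS g v; rewrite touchedU1 negb_or !unplayedU1l.
move=> /andP [tv ve] /andP [_ gU] vg; rewrite (rDS g) // andbT.
by apply: contraNneq ve => <-.
Qed.

Lemma edge_two_ends e : exists u v, [/\ u \in val e, v \in val e & u != v].
Proof.
case: e => /= _ /imsetP [[u v] /= uv ->]; exists u, v.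
rewrite !inE !eqxx orbT; split=> //.
by apply: contraTneq uv => ->; rewrite inE adj_irrefl.
Qed.

(** The first alternative needs no repair: it leaves Dominator's answer open and also covers the end
    of the play. *)
Lemma dominator_reply D S e :
    dominated D S -> reserved D S -> e \in unplayed D S ->
    let S' := S :|: [set e] in
    (dominated D S' /\ reserved D S') \/
    exists2 g, g \in unplayed D S' &
      dominated (D :|: [set g]) S' /\ reserved (D :|: [set g]) S'.
Proof.
move=> dDS rDS eU S'.
have domS' D' v : dominated D' S -> v \in val e -> touched D' v ->
    dominated D' S'.
  by move=> dD' ve tv g; rewrite !inE => /orP [/dD'//|/eqP ->]; exists v.
have [[u [g [tu gU ug fu]]]|noalt] := pselect (exists u g,
    [/\ ~~ touched D u, g \in unplayed D S', u \in val g & f u = e]).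
  (* By injectivity [e] was reserved for [u] alone, and [g] now touches [u]. *)
  right; exists g => //; split.
    apply: (domS' _ u); rewrite ?touchedU1 ?ug ?orbT -?fu //.
    exact: dominatedU1.
  move=> h v; rewrite touchedU1 negb_or => /andP [tv vg].
  rewrite !unplayedU1l !unplayedU1r => /and3P [_ _ hU] vh.
  rewrite (rDS h) // andbT; apply/andP; split.
    by apply: contraNneq vg => <-.
  by rewrite -fu (inj_eq f_inj); apply: contraNneq vg => ->.
(* An untouched [v] with [f v = e] has no free edge left, so nothing is required at [v]. *)
have rDS' : reserved D S'.
  move=> g v tv gU vg; rewrite unplayedU1r; apply/andP; split.
    by apply/eqP => fv; apply: noalt; exists v, g.
  by apply: (rDS g) => //; move: gU; rewrite unplayedU1r => /andP [].
have [v|none] := pickP (fun v => (v \in val e) && touched D v).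
  by case/andP=> ve tv; left; split=> //; apply: domS' tv.
have [w we fwe] : exists2 w, w \in val e & f w != e.
  have [u [v [ue ve uv]]] := edge_two_ends e.
  have [fu|] := eqVneq (f u) e; last by exists u.
  by exists v => //; rewrite -fu (inj_eq f_inj) eq_sym.
have tw : ~~ touched D w by move: (none w); rewrite we /= => ->.
(* Before Staller's move [e] was a free edge at the untouched [w], so [f w] was free as well. *)
right; exists (f w); first by rewrite unplayedU1r fwe (rDS e).
split; last exact: reservedU1.
by apply: (domS' _ w); rewrite ?touchedU1 ?f_inc ?orbT //; apply: dominatedU1.
Qed.

(** Once all edges are played, an edge outside [D] is Staller's, and the edge of [D] at its touched
    end dominates it. *)
Lemma dominated_dominating D S :
  unplayed D S = set0 -> dominated D S -> dominating D.
Proof.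
move=> U0 dDS e; have := in_set0 e; rewrite -U0 !inE => /negbFE.
case/orP => [eD|/dDS [v ve /exists_inP [g gD vg]]].
  by exists e; rewrite ?eqxx.
exists g => //=; rewrite /line_adj; case: eqP => //= _.
by apply/set0Pn; exists v; rewrite inE vg.
Qed.

(** * The play with both biases equal to 1 *)

Lemma legal1 D S e : e \in unplayed D S -> legal 1 D S [set e].
Proof.
move=> eU; split; first by rewrite sub1set.
by rewrite cards1 (minn_idPl _) //; apply/card_gt0P; exists e.
Qed.

Lemma legal1P D S M : unplayed D S <> set0 -> legal 1 D S M ->
  exists2 e, e \in unplayed D S & M = [set e].
Proof.
move=> /eqP U0 [MU]; rewrite (minn_idPl _) ?card_gt0 // => /eqP /cards1P [e ME].
by exists e => //; rewrite -sub1set -ME.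
Qed.

Lemma dom_wins_Staller D S :
  dominated D S -> reserved D S -> dom_wins 1 1 Staller D S.
Proof.
have [n] := ubnP #|unplayed D S|.
elim: n D S => // n IH D S leUn dDS rDS.
have [U0|/eqP U0] := eqVneq (unplayed D S) set0.
  exact: WinsEnd (dominated_dominating U0 dDS).
apply: WinsStaller => // _ /(legal1P U0) [e eU ->].
have subU := unplayedU1r D S e; set S' := S :|: [set e] in subU *.
have ltU : #|unplayed D S'| < #|unplayed D S|.
  apply: proper_card; apply/properP; split.
    by apply/subsetP => g; rewrite subU => /andP [].
  by exists e; rewrite // subU eqxx.
have answer g : g \in unplayed D S' -> dominated (D :|: [set g]) S' ->
    reserved (D :|: [set g]) S' -> dom_wins 1 1 Dominator D S'.
  move=> gU dg rg; apply: (WinsDominator _ (legal1 gU)).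
    by move=> U'0; rewrite U'0 inE in gU.
  apply: IH => //; rewrite -ltnS; apply: leq_trans leUn; rewrite ltnS.
  apply: leq_ltn_trans ltU; apply: subset_leq_card; apply/subsetP => h.
  by rewrite unplayedU1l => /andP [].
case: (dominator_reply dDS rDS eU) => [[d' r']|[g gU []]]; last exact: answer.
(* Dominator may not pass while edges remain, but any extra edge preserves the invariant. *)
have [U'0|/set0Pn [g gU]] := eqVneq (unplayed D S') set0.
  exact: WinsEnd (dominated_dominating U'0 d').
by apply: (answer g gU); [apply: dominatedU1 | apply: reservedU1].
Qed.

Lemma dom_wins_Dominator D S :
  dominated D S -> reserved D S -> dom_wins 1 1 Dominator D S.
Proof.
move=> dDS rDS; have [U0|/set0Pn [g gU]] := eqVneq (unplayed D S) set0.
  exact: WinsEnd (dominated_dominating U0 dDS).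
apply: (WinsDominator _ (legal1 gU)).
  by move=> U0; rewrite U0 inE in gU.
by apply: dom_wins_Staller; [apply: dominatedU1 | apply: reservedU1].
Qed.

Lemma dominated_start : dominated set0 set0.
Proof. by move=> e; rewrite inE. Qed.

Lemma reserved_start : reserved set0 set0.
Proof. by move=> g v _ _ _; rewrite !inE. Qed.

End Strategy.

Lemma least_positive_1 (W : nat -> Prop) : W 1 -> least_positive W = Some 1.
Proof.
move=> W1; rewrite /least_positive; case: pselect => [exW|[]]; last first.
  by exists 1; apply/asboolP.
congr Some; case: ex_minnP => m /andP [m0 _] /(_ 1) m1.
by apply/eqP; rewrite eqn_leq m0 m1 //; apply/asboolP.
Qed.

Theorem corollary13 (H : sgraph) (hH : 2 <= min_degree H) :
  a_Dgame 1 (line_graph H) = Some 1 /\ a_Sgame 1 (line_graph H) = Some 1.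
Proof.
have [f f_inj f_inc] := distinct_incident_edges hH.
have dom0 := @dominated_start H; have res0 := @reserved_start H f.
split; apply: least_positive_1.
- exact: (dom_wins_Dominator f_inj f_inc dom0 res0).
- exact: (dom_wins_Staller f_inj f_inc dom0 res0).
Qed.
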